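(* Let $\beta_0,\beta_1\in(1/2,1)$ with $\beta_0\ge\beta_1$ and let $I=[0,\beta_1/(1-\beta_1)]$. Then: (1) Lebesgue-almost all $x\in I$ have a continuum of $(\beta_0,\beta_1)$-expansions, i.e. the set of $(\beta_0,\beta_1)$-expansions of $x$ has cardinality $2^{\aleph_0}$. (2) If $\beta_1^2+\beta_0>1$, then every $x\in I\setminus\{0,\beta_1/(1-\beta_1)\}$ has a continuum of $(\beta_0,\beta_1)$-expansions.
   Context: Let $\Sigma=\{0,1\}^{\mathbb{N}}$ be the set of sequences $s=(s_i)_{i\ge1}$ of zeros and ones. For $s\in\Sigma$ and $n\ge1$, let $0_n(s)$ be the number of zeros and $1_n(s)$ the number of ones among $s_1,\dots,s_n$. For $\beta_0,\beta_1\in(1/2,1)$ with $\beta_0\ge\beta_1$ and $I=[0,\beta_1/(1-\beta_1)]$, define $\pi_{\beta_0,\beta_1}:\Sigma\to I$ by $$\pi_{\beta_0,\beta_1}(s)=\sum_{i=1}^{\infty}s_i\,\beta_0^{0_i(s)}\beta_1^{1_i(s)}.$$ A sequence $s\in\Sigma$ with $\pi_{\beta_0,\beta_1}(s)=x$ is called a $(\beta_0,\beta_1)$-expansion of $x\in I$. *)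

(* Defs.v *)
From mathcomp Require Import all_boot all_order all_algebra.
From mathcomp Require Import all_classical all_reals all_analysis.
Import Order.TTheory GRing.Theory Num.Theory.
Import numFieldNormedType.Exports.

Set Implicit Arguments.
Unset Strict Implicit.
Unset Printing Implicit Defensive.

Local Open Scope classical_set_scope.
Local Open Scope ring_scope.

(* Sequences are indexed from 0: the mathematical digit s_i (i >= 1) is
   [s i.-1], so [zeros s n] and [ones s n] count among s_1, ..., s_n. *)
Definition zeros (s : nat -> bool) (n : nat) : nat := (\sum_(i < n) ~~ s i)%N.
Definition ones (s : nat -> bool) (n : nat) : nat := (\sum_(i < n) s i)%N.

(* The i-th term is at most b0 ^+ i.+1 when 0 <= b1 <= b0, so for b0 < 1 the
   series converges and the limit below is its actual sum. *)
Definition digit_sum (R : realType) (b0 b1 : R) (s : nat -> bool) : R :=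
  limn (series (fun i =>
    (s i)%:R * b0 ^+ zeros s i.+1 * b1 ^+ ones s i.+1)).

Definition expansions (R : realType) (b0 b1 x : R) : set (nat -> bool) :=
  [set s | digit_sum b0 b1 s = x].

(* [set: nat -> bool] has cardinality 2 ^ aleph_0 by definition. *)
Definition continuum (T : Type) (A : set T) : Prop :=
  (A #= [set: nat -> bool])%card.

(* Main.v *)
Require Import Defs.
From mathcomp Require Import all_boot all_order all_algebra.
From mathcomp Require Import all_classical all_reals all_analysis.
From mathcomp Require Import measurable_realfun ring lra.
Import Order.TTheory GRing.Theory Num.Theory.
Import numFieldNormedType.Exports.

(** Reading a digit replaces x by x / b0 (digit 0) or x / b1 - 1 (digit 1), and
    any digit sequence whose orbit stays in [0, c], c = b1 / (1 - b1), is an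
    expansion of x. Both digits are allowed on the overlap ]b1, b0 c[; elsewhere
    take the greedy digit (1 if and only if x > b1). If every orbit keeps coming
    back to the overlap, the free choices made there embed {0,1}^N into the set
    of expansions. When b1^2 + b0 > 1 the greedy map cannot jump over the overlap,
    so all of ]0, c[ returns.

    In general, let A be the set of points whose greedy orbit avoids the overlap
    and F(a) = |A n ]0, a]|. If F(a) <= r a for all a <= c then, since the greedy
    map is piecewise affine with branches onto intervals starting at 0, pulling
    this bound back and using that A has a hole to the right of b1 gives
    F(a) <= r (1 - d) a for a fixed d > 0. Iterating, A is null, and so are its
    countably many preimages under words of digits. *)

Local Open Scope classical_set_scope.
Local Open Scope ring_scope.

(** * Digit maps, orbits and partial sums of expansions *)

Definition digit_inv {R : realType} (b0 b1 : R) (d : bool) (y : R) : R :=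
  if d then y / b1 - 1 else y / b0.

Fixpoint orbit {R : realType} (b0 b1 : R) (s : nat -> bool) (x : R) (n : nat) : R :=
  if n is m.+1 then digit_inv b0 b1 (s m) (orbit b0 b1 s x m) else x.

Section Orbits.
Context {R : realType}.
Variables b0 b1 : R.
Hypotheses (b1_gt0 : 0 < b1) (b1_le_b0 : b1 <= b0) (b0_lt1 : b0 < 1).

(** Telescoping: [z = digit_inv b0 b1 d y] means [y = b0 * z] or [y = b1 * (z + 1)], so reading a
    digit splits the next term of the series off the remainder. *)
Lemma orbit_partial_sum (s : nat -> bool) (x : R) (n : nat) :
  series (fun i => (s i)%:R * b0 ^+ zeros s i.+1 * b1 ^+ ones s i.+1) n =
  x - b0 ^+ zeros s n * b1 ^+ ones s n * orbit b0 b1 s x n.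
Proof.
have b1n0 : b1 != 0 by rewrite gt_eqF.
have b0n0 : b0 != 0 by rewrite gt_eqF // (lt_le_trans b1_gt0).
elim: n => [|n IHn].
  by rewrite /series /= big_geq // /zeros /ones !big_ord0 !expr0 !mul1r subrr.
rewrite seriesSr IHn /= /zeros /ones !big_ord_recr /= /digit_inv.
case: (s n) => /=; rewrite ?addn0 ?addn1 ?exprS ?mul0r; field; by [].
Qed.

Lemma weight_le (s : nat -> bool) (n : nat) :
  b0 ^+ zeros s n * b1 ^+ ones s n <= b0 ^+ n.
Proof.
have b0_gt0 := lt_le_trans b1_gt0 b1_le_b0.
elim: n => [|n IHn]; first by rewrite /zeros /ones !big_ord0 !expr0 mulr1.
rewrite /zeros /ones !big_ord_recr /= -/(zeros s n) -/(ones s n) exprSr.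
case: (s n) => /=; rewrite ?addn0 ?addn1 exprSr.
  rewrite mulrA; apply: ler_pM => //; last exact: ltW.
  by rewrite mulr_ge0 ?exprn_ge0 ?ltW.
by rewrite mulrAC ler_pM2r.
Qed.

(** A bounded orbit makes the remainder at most [c * b0 ^+ n], which tends to 0. *)
Lemma digit_sum_orbit (s : nat -> bool) (x c : R) :
  (forall n, 0 <= orbit b0 b1 s x n <= c) -> digit_sum b0 b1 s = x.
Proof.
move=> orb; apply/cvg_lim => //.
have b0_gt0 := lt_le_trans b1_gt0 b1_le_b0.
have -> : series (fun i => (s i)%:R * b0 ^+ zeros s i.+1 * b1 ^+ ones s i.+1) =
  (fun n => x - b0 ^+ zeros s n * b1 ^+ ones s n * orbit b0 b1 s x n).
  by apply/funext => n; rewrite (orbit_partial_sum _ x).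
rewrite -[X in _ --> X]subr0; apply: cvgB; first exact: cvg_cst.
apply: (@squeeze_cvgr _ _ _ _ (fun=> 0) (fun n => c * b0 ^+ n)).
- near=> n; have /andP[orb_ge0 orb_le] := orb n.
  have w0 : 0 <= b0 ^+ zeros s n * b1 ^+ ones s n.
    by rewrite mulr_ge0 ?exprn_ge0 ?ltW.
  rewrite mulr_ge0 //= mulrC ler_pM //; exact: weight_le.
- exact: cvg_cst.
- rewrite -[X in _ --> X](mulr0 c); apply: cvgM; first exact: cvg_cst.
  by apply: cvg_expr; rewrite ger0_norm // ltW.
Unshelve. all: by end_near. Qed.

End Orbits.

(** * Coding free choices of digits into expansions *)

Section Branching.
Context {R : realType}.
Variables b0 b1 : R.
Variables (g : R -> bool) (B : set R).

Definition greedy (y : R) : R := digit_inv b0 b1 (g y) y.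

(* The state [(y, k)] is the current orbit point and the number of free digits
   already read from [t]: outside [B] the digit [g y] is forced, inside [B] the
   next digit of [t] is copied. *)
Definition next_digit (t : nat -> bool) (yk : R * nat) : bool :=
  if `[< B yk.1 >] then t yk.2 else g yk.1.

Definition next_state (t : nat -> bool) (yk : R * nat) : R * nat :=
  (digit_inv b0 b1 (next_digit t yk) yk.1,
   if `[< B yk.1 >] then yk.2.+1 else yk.2).

Definition state (t : nat -> bool) (x : R) (n : nat) : R * nat :=
  iter n (next_state t) (x, 0%N).

Definition coded_digits (x : R) (t : nat -> bool) (n : nat) : bool :=
  next_digit t (state t x n).

Lemma orbit_coded_digits x t n :
  orbit b0 b1 (coded_digits x t) x n = (state t x n).1.
Proof. by elim: n => //= n ->. Qed.

Variable G : set R.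
Hypothesis greedyG : forall y, G y -> G (greedy y).
Hypothesis branchG : forall y d, G y -> B y -> G (digit_inv b0 b1 d y).
Hypothesis hitB : forall y, G y -> exists n, B (iter n greedy y).

Lemma stateG x t n : G x -> G (state t x n).1.
Proof.
move=> Gx; elim: n => //= n IHn; rewrite /next_digit.
by case: asboolP => By; [exact: branchG | exact: greedyG].
Qed.

(** Outside [B] the state moves by [greedy] and the counter stands still, so induction on the
    hitting time of [B] applies. *)
Lemma state_hits x t n : G x ->
  exists2 m, B (state t x m).1 & (state t x m).2 = (state t x n).2.
Proof.
move=> Gx; have [i] := hitB _ (stateG x t n Gx).
elim: i n => [|i IHi] n; first by exists n.
have [By _|nB] := pselect (B (state t x n).1); first by exists n.
rewrite iterSr.
have E : state t x n.+1 = (greedy (state t x n).1, (state t x n).2).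
  by rewrite /= /next_state /next_digit asboolF.
have := IHi n.+1; rewrite E /= => IH /IH [m Bm km]; exists m => //.
Qed.

Lemma state_reads x t k : G x -> exists2 m, B (state t x m).1 & (state t x m).2 = k.
Proof.
move=> Gx; elim: k => [|k [m Bm km]]; first exact: (state_hits x t 0).
have [m' Bm' km'] := state_hits x t m.+1 Gx; exists m' => //.
by rewrite km' /= asboolT // km.
Qed.

(* The digits read so far determine the current state, hence also [t]. *)
Lemma coded_digits_inj x : G x -> injective (coded_digits x).
Proof.
move=> Gx t t' eqs.
have eqst n : state t x n = state t' x n.
  elim: n => //= n IHn; have := congr1 (@^~ n) eqs; rewrite /coded_digits IHn.
  by rewrite /next_state => ->.
apply/funext => k; have [m Bm km] := state_reads x t k Gx.
have := congr1 (@^~ m) eqs; rewrite /coded_digits /next_digit -eqst asboolT //.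
by rewrite km.
Qed.

(** Expansions form a subset of [[set: nat -> bool]], so an injection the other way suffices; [G]
    inside [[0, c]] bounds every coded orbit, which makes each code an expansion. *)
Lemma continuum_of_branching (c x : R) :
    0 < b1 -> b1 <= b0 -> b0 < 1 -> G `<=` `[0, c] -> G x ->
  continuum (expansions b0 b1 x).
Proof.
move=> b1_gt0 b1_le_b0 b0_lt1 Gc Gx; rewrite /continuum card_eq_le.
rewrite (subset_card_le (@subsetT _ _)) /=.
suff [f] : $|{injfun [set: nat -> bool] >-> expansions b0 b1 x}| by exact: inj_card_le f.
apply/injfunPex.
exists (coded_digits x) => [t _ /=|t t' _ _]; last exact: coded_digits_inj.
rewrite /expansions /=; apply: (digit_sum_orbit _ _ _ _ _ _ _ c) => // n.
by rewrite orbit_coded_digits; have /Gc := stateG x t n Gx; rewrite /= in_itv.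
Qed.

End Branching.

(** * Contraction of the mass of an invariant set with a hole *)

Lemma exists_small_power {R : realType} (b e : R) :
  0 <= b -> b < 1 -> 0 < e -> exists j, b ^+ j < e.
Proof.
move=> b_ge0 b_lt1 e_gt0; have : (fun n => b ^+ n) @ \oo --> (0 : R).
  by apply: cvg_expr; rewrite ger0_norm.
move=> /cvgr_lt /(_ _ e_gt0) [N _ HN]; exists N; exact: (HN N (leqnn N)).
Qed.

(* [m p q] stands for the measure of a set, on the interval ]p, q], that the
   greedy map sends into itself. *)
Section NoMass.
Context {R : realType}.
Variables (b0 b1 : R) (m : R -> R -> R).
Hypotheses (b0_lt1 : b0 < 1) (b1_gthalf : 1 / 2 < b1) (b1_le_b0 : b1 <= b0).
Let c : R := b1 / (1 - b1).

Hypothesis m_le : forall p q, p <= q -> m p q <= q - p.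
Hypothesis m_split : forall p r q, p <= r -> r <= q -> m p q = m p r + m r q.
Hypothesis m_left : forall p q, q <= b1 -> m p q <= b0 * m (p / b0) (q / b0).
Hypothesis m_right : forall p q, b1 <= p -> m p q <= b1 * m (p / b1 - 1) (q / b1 - 1).
Hypothesis m_hole : forall q, q < b0 * c -> m b1 q = 0.

Let b1_gt0 : 0 < b1. Proof. by apply: lt_trans b1_gthalf; rewrite divr_gt0. Qed.
Let b0_gt0 : 0 < b0. Proof. exact: lt_le_trans b1_le_b0. Qed.
Let b1_lt1 : 1 - b1 > 0. Proof. by rewrite subr_gt0 (le_lt_trans b1_le_b0). Qed.
Let cE : c * (1 - b1) = b1. Proof. by rewrite /c divfK // gt_eqF. Qed.
Let c_gt0 : 0 < c. Proof. exact: divr_gt0. Qed.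
Let bounds : [/\ 1 / 2 < b1, b1 <= b0, b0 < 1 & c * (1 - b1) = b1].
Proof. by []. Qed.
(** The overlap is nonempty: multiplied by [1 - b1], the claim reduces to [1 < b0 + b1]. *)
Let b1_lt_b0c : b1 < b0 * c.
Proof.
have [b1_lo b1_b0 b0_hi _] := bounds.
by rewrite -(ltr_pM2r b1_lt1) -mulrA cE [ltRHS]mulrC ltr_pM2l //; lra.
Qed.

Lemma expanded_left_le_top u : u <= b1 -> u / b0 <= c.
Proof.
by move=> ub; rewrite ler_pdivrMr // mulrC (le_trans ub) // ltW.
Qed.

Lemma expanded_right_le_top u : u <= c -> u / b1 - 1 <= c.
Proof.
have [b1_lo b1_b0 b0_hi cK] := bounds.
move=> uc; rewrite lerBlDr ler_pdivrMr //.
nra.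
Qed.

(** The left endpoint goes to [b1] under [j] digits 0 and then to 0 under a digit 1, where [Hr]
    applies. The stretching of a branch cancels against its factor in [m_left] or [m_right], so the
    slope [r] is preserved. *)
Lemma mass_above (r : R) : 0 <= r -> (forall a, 0 <= a <= c -> m 0 a <= r * a) ->
  forall j u, b0 ^+ j * b1 <= u -> u <= c ->
    m (b0 ^+ j * b1) u <= r * (u - b0 ^+ j * b1).
Proof.
have [b1_lo b1_b0 b0_hi cK] := bounds.
move=> r0 Hr.
have right u : b1 <= u -> u <= c -> m b1 u <= r * (u - b1).
  move=> bu uc; apply: le_trans (m_right _ _ (lexx b1)) _.
  rewrite divff ?gt_eqF // subrr.
  apply: le_trans (_ : b1 * (r * (u / b1 - 1)) <= _).
    rewrite ler_pM2l //; apply: Hr; rewrite expanded_right_le_top // andbT.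
    by rewrite subr_ge0 ler_pdivlMr // mul1r.
  by rewrite le_eqVlt; apply/orP; left; apply/eqP; field; rewrite gt_eqF.
elim=> [|j IHj] u; first by rewrite expr0 mul1r; exact: right.
have pj_gt0 : 0 < b0 ^+ j by rewrite exprn_gt0.
have pj_le1 : b0 ^+ j <= 1 by rewrite exprn_ile1 // ltW.
have vE : b0 ^+ j.+1 * b1 / b0 = b0 ^+ j * b1.
  by rewrite exprS; field; rewrite gt_eqF.
have left v : b0 ^+ j.+1 * b1 <= v -> v <= b1 ->
    m (b0 ^+ j.+1 * b1) v <= r * (v - b0 ^+ j.+1 * b1).
  move=> bv vb; apply: le_trans (m_left _ _ vb) _; rewrite vE.
  apply: le_trans (_ : b0 * (r * (v / b0 - b0 ^+ j * b1)) <= _).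
    rewrite ler_pM2l //; apply: IHj; last exact: expanded_left_le_top.
    by rewrite -vE ler_pM2r ?invr_gt0.
  rewrite le_eqVlt exprS; apply/orP; left; apply/eqP; field; by rewrite gt_eqF.
(* An interval reaching past [b1] is cut there, one branch for each piece. *)
move=> bu uc; have [ub|bu'] := leP u b1; first exact: left.
have lb : b0 ^+ j.+1 * b1 <= b1.
  by rewrite -[leRHS]mul1r ler_pM2r // exprn_ile1 // ltW.
rewrite (m_split _ b1) ?(ltW bu') //.
have h1 := left _ lb (lexx _).
have h2 := right _ (ltW bu') uc.
lra.
Qed.

(* The hole contains the greedy cylinder of length [b1 * (b0 ^+ j * b1)] starting
   at [b1]; [mass_above] bounds the mass to the right of it without loss. *)
Lemma mass_gain (r : R) (j : nat) : 0 <= r ->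
    b1 + b1 * (b0 ^+ j * b1) < b0 * c -> b1 + b1 * (b0 ^+ j * b1) <= b1 / b0 ->
    (forall a, 0 <= a <= c -> m 0 a <= r * a) ->
  forall a, 0 <= a <= c -> m 0 a <= r * (1 - b0 ^+ j * b1 * (1 - b1)) * a.
Proof.
have [b1_lo b1_b0 b0_hi cK] := bounds.
set v := b0 ^+ j * b1 => r0 vc vb0 Hr.
have v0 : 0 < v by rewrite mulr_gt0 ?exprn_gt0.
(* [d] is the cylinder length [b1 * v] divided by [c]; hence, for [a <= c], losing [r * b1 * v]
   loses at least the fraction [d] of [r * a]. *)
set d := v * (1 - b1).
have dc : d * c = b1 * v by rewrite /d -mulrA [_ * c]mulrC cE mulrC.
have d0 : 0 < d by rewrite mulr_gt0.
have b1c : b1 <= c by nra.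
have far a : b1 + b1 * v <= a -> a <= c -> m 0 a <= r * (1 - d) * a.
  move=> va ac; have h : b1 <= b1 + b1 * v by rewrite lerDl ltW // mulr_gt0.
  rewrite (m_split 0 b1); [|exact: ltW|exact: le_trans va].
  rewrite (m_split b1 (b1 + b1 * v)) // m_hole // add0r.
  have h1 : m 0 b1 <= r * b1 by apply: Hr; rewrite ltW.
  have h2 : m (b1 + b1 * v) a <= r * (a - b1 - b1 * v).
    apply: le_trans (m_right _ _ h) _.
    have -> : (b1 + b1 * v) / b1 - 1 = v by field; rewrite gt_eqF.
    apply: le_trans (_ : b1 * (r * (a / b1 - 1 - v)) <= _).
      rewrite ler_pM2l //; apply: mass_above => //; last exact: expanded_right_le_top.
      by rewrite -/v lerBrDr ler_pdivlMr //; lra.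
    by rewrite le_eqVlt; apply/orP; left; apply/eqP; field; rewrite gt_eqF.
  have h3 : d * a <= b1 * v by rewrite -dc ler_pM2l.
  nra.
(* A digit 0 sends [b1] to [b1 / b0], which by [vb0] is not below the end of the cylinder, so [far]
   applies there. *)
have at_b1 : m 0 b1 <= r * (1 - d) * b1.
  apply: le_trans (m_left _ _ (lexx b1)) _; rewrite mul0r.
  apply: le_trans (_ : b0 * (r * (1 - d) * (b1 / b0)) <= _).
    rewrite ler_pM2l //; apply: far => //; exact: expanded_left_le_top.
  by rewrite le_eqVlt; apply/orP; left; apply/eqP; field; rewrite gt_eqF.
have b1v : b1 + b1 * v <= c by nra.
have d1 : d <= 1.
  have : d * c <= 1 * c by rewrite dc; nra.
  by rewrite ler_pM2r.
have right a : b1 <= a -> a <= c -> m 0 a <= r * (1 - d) * a.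
  move=> ba ac; have [av|va] := leP (b1 + b1 * v) a; first exact: far.
  (* Inside the hole no mass is added past [b1], so the bound at [b1] carries over. *)
  rewrite (m_split 0 b1) ?(ltW b1_gt0) // m_hole ?addr0; last exact: lt_trans vc.
  apply: le_trans at_b1 _; apply: ler_wpM2l => //; apply: mulr_ge0 => //; lra.
(* Digits 0 push a small [a] up beyond [b1] without changing the slope. *)
have left n : forall a, b0 ^+ n * b1 <= a -> a <= c -> m 0 a <= r * (1 - d) * a.
  elim: n => [|n IHn] a; first by rewrite expr0 mul1r; exact: right.
  move=> na ac; have [ba|ab] := leP b1 a; first exact: right.
  apply: le_trans (m_left _ _ (ltW ab)) _; rewrite mul0r.
  apply: le_trans (_ : b0 * (r * (1 - d) * (a / b0)) <= _).
    rewrite ler_pM2l //; apply: IHn; last by apply/expanded_left_le_top/ltW.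
    by rewrite ler_pdivlMr // mulrAC -exprSr.
  by rewrite le_eqVlt; apply/orP; left; apply/eqP; field; rewrite gt_eqF.
move=> a /andP[]; rewrite le_eqVlt => /predU1P[<-|a0] ac.
  by rewrite mulr0; have := m_le 0 0 (lexx _); rewrite subrr.
have [n nlt] := exists_small_power b0 _ (ltW b0_gt0) b0_lt1 (divr_gt0 a0 b1_gt0).
by apply: (left n) => //; rewrite -ler_pdivlMr // ltW.
Qed.

Lemma mass_eq0 : m 0 c <= 0.
Proof.
have [b1_lo b1_b0 b0_hi cK] := bounds.
(* With [b0 ^+ j] below this minimum, the cylinder fits in the hole and ends before [b1 / b0], as
   [mass_gain] requires. *)
have e0 : 0 < Num.min ((b0 * c - b1) / b1 / b1) ((b1 / b0 - b1) / b1 / b1).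
  rewrite lt_min !divr_gt0 ?subr_gt0 //=.
  by rewrite ltr_pdivlMr // -[ltRHS]mulr1 ltr_pM2l.
have [j] := exists_small_power b0 _ (ltW b0_gt0) b0_lt1 e0; rewrite lt_min !ltr_pdivlMr // => /andP[j1 j2].
pose d := b0 ^+ j * b1 * (1 - b1).
have v0 : 0 < b0 ^+ j * b1 by rewrite mulr_gt0 ?exprn_gt0.
have d0 : 0 < d by rewrite mulr_gt0.
have v1 : b0 ^+ j * b1 <= 1.
  by apply: mulr_ile1; rewrite ?exprn_ge0 ?exprn_ile1 ?ltW //; lra.
have d1 : d <= 1 by rewrite /d; nra.
(* The iteration starts from slope 1, the trivial bound of mass by length. *)
have all_n n : forall a, 0 <= a <= c -> m 0 a <= (1 - d) ^+ n * a.
  elim: n => [|n IHn] a.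
    by move=> /andP[a0 _]; rewrite expr0 mul1r -[leRHS]subr0 m_le.
  rewrite exprSr; apply: mass_gain IHn a; first by rewrite exprn_ge0 // subr_ge0.
    by lra.
  by lra.
have lim0 : (fun n => (1 - d) ^+ n * c) @ \oo --> (0 : R).
  rewrite -[X in _ --> X](mul0r c); apply: cvgM; last exact: cvg_cst.
  by apply: cvg_expr; rewrite ger0_norm ?subr_ge0 //; lra.
apply: (cvgr_to_ge lim0); near=> n; apply: all_n; by rewrite lexx ltW.
Unshelve. all: by end_near. Qed.

End NoMass.

(** * Lebesgue measure under affine maps *)

Section AffinePreimage.
Context {R : realType}.
Notation mu := (@lebesgue_measure R).

Lemma measurable_affine (r t : R) :
  measurable_fun [set: measurableTypeR R] (fun x : measurableTypeR R => x / r + t : measurableTypeR R).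
Proof. by apply: measurable_funD => //; apply: measurable_funM. Qed.

(** The pushforward scaled by [r^-1] gives half-open intervals their length, so it is Lebesgue
    measure by uniqueness. *)
Lemma lebesgue_measure_affine (r t : R) (A : set R) : 0 < r -> measurable A ->
  mu ((fun x => x / r + t) @^-1` A) = (r%:E * mu A)%E.
Proof.
move=> r0 mA.
have r0' : 0 <= r^-1 by rewrite invr_ge0 ltW.
pose f : measurableTypeR R -> measurableTypeR R := fun x => x / r + t.
pose nu : {measure set (measurableTypeR R) -> \bar R} :=
  mscale (NngNum r0') (pushforward mu f).
have H : forall X : set (measurableTypeR R), measurable X ->
    mu X = nu (measurable_affine r t) X.
  apply: lebesgue_measure_unique => _ [[a b]] _ <-.
  rewrite /nu /= /mscale /= /pushforward.
  have -> : f @^-1` `]a, b]%classic = `](a - t) * r, (b - t) * r]%classic.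
    apply/seteqP; split => x /=; rewrite !in_itv /= => /andP[ax xb].
      by rewrite -ltr_pdivlMr // -ler_pdivrMr // ltrBlDr lerBrDr ax.
    by move: ax xb; rewrite -ltr_pdivlMr // -ler_pdivrMr // ltrBlDr lerBrDr => -> ->.
  rewrite !lebesgue_measure_itv /= !lte_fin ltr_pM2r // ltrD2r.
  case: ifP => _; last by rewrite mule0.
  by rewrite -!EFinB -EFinM; congr EFin; field; rewrite gt_eqF.
by rewrite [in RHS]H // /nu /= /mscale /= muleA -EFinM divff ?gt_eqF // mul1e.
Qed.

End AffinePreimage.

Lemma negligible_affine_preimage {R : realType} (r t : R) (A : set R) : 0 < r ->
  (@lebesgue_measure R).-negligible A ->
  (@lebesgue_measure R).-negligible ((fun x => x / r + t) @^-1` A).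
Proof.
move=> r_gt0 [N [mN N0 AN]]; exists ((fun x => x / r + t) @^-1` N); split.
- by rewrite -[X in measurable X]setTI; exact: measurable_affine.
- have := lebesgue_measure_affine r t N r_gt0 mN.
  by rewrite N0 mule0.
- by move=> x /AN.
Qed.

(** * The greedy map on the open interval and its visits to the overlap *)

Section Expansions.
Context {R : realType}.
Variables b0 b1 : R.
Hypotheses (b0_lt1 : b0 < 1) (b1_gthalf : 1 / 2 < b1) (b1_le_b0 : b1 <= b0).
Notation mu := (@lebesgue_measure R).

Let c : R := b1 / (1 - b1).
Let overlap : set R := `]b1, b0 * c[.
Let gr : R -> R := greedy b0 b1 (fun y => b1 < y).

Let bounds : [/\ 1 / 2 < b1, b1 <= b0, b0 < 1, 0 < b1 & 0 < b0].
Proof. by move: b1_gthalf b1_le_b0 => lo le; split => //; lra. Qed.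

Let facts : [/\ 0 < c, c * (1 - b1) = b1, b1 < b0 * c & b0 * c < c].
Proof.
have [b1_lo b1_b0 b0_hi b1_0 b0_0] := bounds.
have b1_1 : 0 < 1 - b1 by lra.
have c0 : 0 < c by exact: divr_gt0.
have cK : c * (1 - b1) = b1 by rewrite /c divfK // gt_eqF.
split => //.
  by rewrite -(ltr_pM2r b1_1) -mulrA cK [ltRHS]mulrC ltr_pM2l //; lra.
by rewrite -[ltRHS]mul1r ltr_pM2r.
Qed.

Let greedy_left y : y <= b1 -> gr y = y / b0.
Proof. by move=> yb; rewrite /gr /greedy ltNge yb. Qed.

Let greedy_right y : b1 < y -> gr y = y / b1 - 1.
Proof. by move=> yb; rewrite /gr /greedy yb. Qed.

Let left_inv_in y : 0 < y < b0 * c -> 0 < digit_inv b0 b1 false y < c.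
Proof.
have [_ _ _ _ b0_0] := bounds.
by move=> /andP[y0 yc]; rewrite /digit_inv divr_gt0 //= ltr_pdivrMr // mulrC.
Qed.

Let right_inv_in y : b1 < y < c -> 0 < digit_inv b0 b1 true y < c.
Proof.
have [_ _ _ b1_0 b0_0] := bounds; have [_ cK _ _] := facts.
move=> /andP[yb yc]; rewrite /digit_inv subr_gt0 ltr_pdivlMr // mul1r yb /=.
rewrite ltrBlDr ltr_pdivrMr //; nra.
Qed.

Let greedy_in y : 0 < y < c -> 0 < gr y < c.
Proof.
have [_ _ b1_b0c _] := facts.
move=> /andP[y0 yc]; have [yb|yb] := leP y b1.
  by rewrite greedy_left //; apply: left_inv_in; rewrite y0 (le_lt_trans yb).
by rewrite greedy_right //; apply: right_inv_in; rewrite yb.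
Qed.

Let branch_in y d : overlap y -> 0 < digit_inv b0 b1 d y < c.
Proof.
have [_ _ _ b0c_c] := facts; have [_ _ _ b1_0 _] := bounds.
rewrite /overlap /= in_itv /= => /andP[yb yc]; case: d.
  by apply: right_inv_in; rewrite yb (lt_trans yc).
by apply: left_inv_in; rewrite yc (lt_trans b1_0).
Qed.

(** The point [c] is fixed by the digit 1 map, so each step right of the overlap multiplies the
    distance to [c] by [1 / b1], until it exceeds [c * (1 - b0)], the distance from [c] to the
    overlap. *)
Lemma greedy_hits_from_right n y : 1 < b1 ^+ 2 + b0 -> b1 < y < c ->
  b1 ^+ n * (c * (1 - b0)) < c - y -> exists k, overlap (iter k gr y).
Proof.
have [b1_lo b1_b0 b0_hi b1_0 b0_0] := bounds; have [c0 cK b1_b0c b0c_c] := facts.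
move=> hb; elim: n y => [|n IHn] y /andP[yb yc].
  rewrite expr0 mul1r => cy; exists 0%N; rewrite /overlap /= in_itv /= yb.
  by move: cy; rewrite mulrBr mulr1 ltrD2l ltrN2 mulrC.
move=> cy; have [yb0|yb0] := ltP y (b0 * c).
  by exists 0%N; rewrite /overlap /= in_itv /= yb.
have gy : c - gr y = (c - y) / b1.
  rewrite greedy_right //.
  have -> : c - (y / b1 - 1) = (b1 * c + b1 - y) / b1 by field; rewrite gt_eqF.
  by congr (_ / _); nra.
(* Here [hb] enters: it amounts to [b1 * (1 + b1) < b0 * c], so a point at or beyond [b0 * c] lands
   beyond [b1] and cannot jump over the overlap. *)
have gyc : b1 < gr y < c.
  have /andP[_ ->] : 0 < gr y < c by apply: greedy_in; rewrite yc (lt_trans b1_0).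
  rewrite andbT greedy_right // ltrBrDr ltr_pdivlMr //.
  apply: lt_le_trans yb0.
  have b1_1 : 0 < 1 - b1 by lra.
  by rewrite -(ltr_pM2r b1_1) -[ltRHS]mulrA cK; nra.
have [|k hk] := IHn (gr y) gyc; last by exists k.+1; rewrite iterSr.
by rewrite gy ltr_pdivlMr // mulrAC -exprSr.
Qed.

Lemma greedy_hits_overlap y : 1 < b1 ^+ 2 + b0 -> 0 < y < c ->
  exists k, overlap (iter k gr y).
Proof.
have [b1_lo b1_b0 b0_hi b1_0 b0_0] := bounds; have [c0 cK b1_b0c b0c_c] := facts.
move=> hb.
have right z : b1 < z < c -> exists k, overlap (iter k gr z).
  move=> zc; have e0 : 0 < (c - z) / (c * (1 - b0)).
    case/andP: zc => _ z_lt; apply: divr_gt0; first by rewrite subr_gt0.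
    by apply: mulr_gt0; rewrite ?subr_gt0.
  have [|n] := exists_small_power b1 _ (ltW b1_0) _ e0; first by lra.
  rewrite ltr_pdivlMr => [hn|]; last by apply: mulr_gt0; rewrite ?subr_gt0.
  exact: (greedy_hits_from_right n).
(* Small points are stretched by [1 / b0] until they pass [b1]. *)
have left n : forall z, 0 < z < c -> b0 ^+ n * b1 < z ->
    exists k, overlap (iter k gr z).
  elim: n => [|n IHn] z /andP[z0 zc].
    by rewrite expr0 mul1r => zb; apply: right; rewrite zb.
  move=> zn; have [zb|zb] := leP z b1; last by apply: right; rewrite zb.
  have [||k hk] := IHn (gr z); last by exists k.+1; rewrite iterSr.
    by apply: greedy_in; rewrite z0.
  by rewrite greedy_left // ltr_pdivlMr // mulrAC -exprSr.
move=> yc; have /andP[y0 _] := yc.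
have [n] := exists_small_power b0 _ (ltW b0_0) b0_hi (divr_gt0 y0 b1_0).
by rewrite ltr_pdivlMr // => /(left n y yc).
Qed.

Lemma continuum_interior y : 1 < b1 ^+ 2 + b0 -> 0 < y < c ->
  continuum (expansions b0 b1 y).
Proof.
have [b1_lo b1_b0 b0_hi b1_0 b0_0] := bounds.
move=> hb yc.
apply: (continuum_of_branching b0 b1 (fun y => b1 < y) overlap
  [set y | 0 < y < c] _ _ _ c) => //.
- by move=> z d _; exact: branch_in.
- by move=> z zc; exact: greedy_hits_overlap.
- by move=> z /= /andP[z0 zc]; rewrite in_itv /= !ltW.
Qed.

(** * The exceptional null set *)

Let avoiding : set R := [set y | 0 < y < c /\ forall n, ~ overlap (iter n gr y)].

Lemma measurable_avoiding : measurable (avoiding : set (measurableTypeR R)).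
Proof.
have mgr : measurable_fun [set: measurableTypeR R] (gr : R -> measurableTypeR R).
  rewrite /gr /greedy /digit_inv; apply: measurable_fun_if => //.
  - exact: measurable_fun_ltr.
  - apply: measurable_funTS; exact: (measurable_affine b1 (-1)).
  - apply: measurable_funTS; have := measurable_affine b0 0.
    by under eq_fun do rewrite addr0.
have mit n : measurable_fun [set: measurableTypeR R] (iter n gr : R -> measurableTypeR R).
  elim: n => [|n IHn]; first exact: measurable_id.
  exact: (measurableT_comp mgr IHn).
have -> : avoiding = `]0, c[ `&` \bigcap_n (iter n gr @^-1` (~` overlap)).
  apply/seteqP; split => y; rewrite /avoiding /= in_itv /=.
    by move=> [yc H]; split => // n _; exact: H.
  by move=> [yc H]; split => // n; exact: (H n).
apply: measurableI => //; apply: bigcapT_measurable => n.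
rewrite -[X in measurable X]setTI; apply: mit => //.
by apply: measurableC; exact: measurable_itv.
Qed.

Let mass (p q : R) : R := fine (mu (avoiding `&` `]p, q])).

Let m_piece p q : measurable (avoiding `&` `]p, q] : set (measurableTypeR R)).
Proof. by apply: measurableI => //; exact: measurable_avoiding. Qed.

Let mass_fin p q : mu (avoiding `&` `]p, q]) \is a fin_num.
Proof.
rewrite ge0_fin_numE ?measure_ge0 //.
apply: (@le_lt_trans _ _ (mu `]p, q])).
  by apply: le_measure; rewrite ?inE //; exact: m_piece.
by rewrite lebesgue_measure_itv /=; case: ifP => _; rewrite ?ltry // -EFinB ltry.
Qed.

(** The hypothesis puts the piece of [avoiding] on []p, q]] inside an affine preimage; only this
    inclusion is known, hence an inequality. *)
Let mass_affine (r t p q : R) : 0 < r ->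
  (forall x, avoiding x -> p < x <= q -> avoiding (x / r + t)) ->
  mass p q <= r * mass (p / r + t) (q / r + t).
Proof.
move=> r0 H; rewrite -lee_fin EFinM !fineK //.
rewrite -(lebesgue_measure_affine r t) //; last exact: m_piece.
apply: le_measure; rewrite ?inE; first exact: m_piece.
  rewrite -[X in measurable X]setTI.
  by apply: measurable_affine => //; exact: m_piece.
move=> x [Ax]; rewrite /= !in_itv /= => /andP[px xq]; split.
  by apply: H => //; rewrite px.
by rewrite ltrD2r lerD2r ltr_pM2r ?ler_pM2r ?invr_gt0 // px.
Qed.

Let avoiding_greedy y : avoiding y -> avoiding (gr y).
Proof.
move=> [yc H]; split; first exact: greedy_in.
by move=> n; have := H n.+1; rewrite iterSr.
Qed.

Lemma negligible_avoiding : mu.-negligible avoiding.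
Proof.
have [b1_lo b1_b0 b0_hi b1_0 b0_0] := bounds; have [c0 cK b1_b0c b0c_c] := facts.
have mc : mass 0 c <= 0.
  apply: (mass_eq0 b0 b1) => //.
  - move=> p q pq; rewrite -lee_fin fineK //.
    apply: (@le_trans _ _ (mu `]p, q])).
      by apply: le_measure; rewrite ?inE //; exact: m_piece.
    rewrite lebesgue_measure_itv /= lte_fin; case: ifP => _ //.
    by rewrite lee_fin subr_ge0.
  - move=> p r q pr rq; rewrite /mass -fineD // -measureU //; try exact: m_piece.
      rewrite -setIUr; congr (fine (mu (_ `&` _))).
      apply/seteqP; split => x /=; rewrite !in_itv /=.
        move=> /andP[px xq]; have [xr|xr] := leP x r.
          by left; rewrite px.
        by right.
      move=> [/andP[px xr]|/andP[rx xq]].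
        by rewrite px (le_trans xr).
      by rewrite xq andbT (le_lt_trans pr).
    apply/seteqP; split => x //= [[_ +] [_ +]]; rewrite !in_itv /=.
    by move=> /andP[_ xr] /andP[rx _]; move: (lt_le_trans rx xr); rewrite ltxx.
  - move=> p q qb; rewrite -[p / b0]addr0 -[q / b0]addr0.
    apply: mass_affine => // x Ax /andP[_ xq].
    by rewrite addr0 -greedy_left ?(le_trans xq) //; exact: avoiding_greedy.
  - move=> p q pb; apply: mass_affine => // x Ax /andP[px _].
    by rewrite -greedy_right ?(le_lt_trans pb) //; exact: avoiding_greedy.
  (* The hole comes from iterate 0: a point of [avoiding] is itself outside the overlap. *)
  - move=> q qc; rewrite /mass (_ : _ `&` _ = set0) ?measure0 //.
    apply/seteqP; split => x //= [[_ /(_ 0%N)]] /=; rewrite /overlap /= !in_itv /=.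
    by move=> H /andP[bx xq]; apply: H; rewrite bx (le_lt_trans xq).
apply/negligibleP; first exact: measurable_avoiding.
have -> : avoiding = avoiding `&` `]0, c].
  apply/seteqP; split => x; last by case.
  move=> Ax; split => //; case: Ax => /andP[x0 xc] _.
  by rewrite /= in_itv /= x0 ltW.
apply/eqP; rewrite eq_le measure_ge0 andbT.
by move: mc; rewrite -lee_fin fineK.
Qed.

(* Points that some word of at most [n] digits sends into [avoiding]. *)
Let pre_avoiding (n : nat) : set R :=
  iter n (fun E => E `|` (digit_inv b0 b1 false @^-1` E `|`
                          digit_inv b0 b1 true @^-1` E)) avoiding.

Lemma negligible_pre_avoiding : mu.-negligible (\bigcup_n pre_avoiding n).
Proof.
have [b1_lo b1_b0 b0_hi b1_0 b0_0] := bounds.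
apply: negligible_bigcup; elim=> [|n IHn]; first exact: negligible_avoiding.
apply: negligibleU => //; apply: negligibleU; last first.
  exact: (negligible_affine_preimage b1 (-1)).
have := negligible_affine_preimage b0 0 _ b0_0 IHn.
by under eq_fun do rewrite addr0.
Qed.

(** The complement of the null set is stable under both digit maps, so no free choice can lead into
    [avoiding], and every greedy orbit started later still meets the overlap. *)
Lemma continuum_generic y : 0 < y < c -> ~ (\bigcup_n pre_avoiding n) y ->
  continuum (expansions b0 b1 y).
Proof.
have [b1_lo b1_b0 b0_hi b1_0 b0_0] := bounds.
have step z d : ~ (\bigcup_n pre_avoiding n) z ->
    ~ (\bigcup_n pre_avoiding n) (digit_inv b0 b1 d z).
  move=> nz [n _ En]; apply: nz; exists n.+1 => //; right.
  by case: d En; [right | left].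
move=> yc ny.
apply: (continuum_of_branching b0 b1 (fun y => b1 < y) overlap
  [set y | 0 < y < c /\ ~ (\bigcup_n pre_avoiding n) y] _ _ _ c) => //.
- by move=> z [zc nz]; split; [exact: greedy_in | exact: step].
- by move=> z d [zc nz] Bz; split; [exact: branch_in | exact: step].
- move=> z [zc nz]; apply: contrapT => H; apply: nz; exists 0%N => //.
  by split => // n Bn; apply: H; exists n.
- by move=> z /= [/andP[z0 zc] _]; rewrite in_itv /= !ltW.
Qed.

End Expansions.

Theorem theorem4p1 (R : realType) (b0 b1 : R)
    (hb0 : 1 / 2 < b0 < 1) (hb1 : 1 / 2 < b1 < 1) (hle : b1 <= b0) :
  {ae @lebesgue_measure R, forall x : R,
     x \in `[0, b1 / (1 - b1)] -> continuum (expansions b0 b1 x)} /\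
  (b1 ^+ 2 + b0 > 1 ->
   forall x : R, x \in `[0, b1 / (1 - b1)] ->
     x <> 0 -> x <> b1 / (1 - b1) ->
     continuum (expansions b0 b1 x)).
Proof.
have [/andP[_ b0_lt1] /andP[b1_gt _]] := (hb0, hb1).
have inside (x : R) : x \in `[0, b1 / (1 - b1)] -> x <> 0 ->
    x <> b1 / (1 - b1) -> 0 < x < b1 / (1 - b1).
  rewrite in_itv /= => /andP[x0 xc] /eqP nx0 /eqP nxc.
  by rewrite !lt_neqAle x0 xc eq_sym nx0 nxc.
split=> [|hb x xI x0 xc]; last by apply: continuum_interior => //; exact: inside.
have N0 (a : R) : (@lebesgue_measure R).-negligible [set a].
  by apply/negligibleP => //; exact: lebesgue_measure_set1.
(* The two endpoints join the null set, since [continuum_generic] concerns interior points. *)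
apply: negligibleS (negligibleU (negligible_pre_avoiding b0 b1 b0_lt1 b1_gt hle)
  (negligibleU (N0 0) (N0 (b1 / (1 - b1))))).
move=> x /=; apply: contra_notP => /not_orP[nE /not_orP[x0 xc]] xI.
by apply: continuum_generic => //; exact: inside.
Qed.
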